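(* Let $\sigma$ be a pre-stability condition on a $k$-linear triangulated category $\mathcal{D}$. For any exact triangle $E\to F\to G$ in $\mathcal{D}$ and any real numbers $a,t$ one has \[ 0\le m_\sigma^t(E)+m_\sigma^t(G)-m_\sigma^t(F)\le(1+e^{|t|})\left(m_\sigma^t(G^{>a})+m_\sigma^t(E^{\le a})\right). \]
   Context: $k$ is a field. A pre-stability condition $\sigma=(Z,\mathcal{P})$ on $\mathcal{D}$ consists of a group homomorphism $Z:K_0(\mathcal{D})\to\mathbf{C}$ and a slicing, i.e. a collection $\mathcal{P}=\{\mathcal{P}(\phi)\}_{\phi\in\mathbf{R}}$ of full additive subcategories of $\mathcal{D}$, such that: (a) $\mathrm{Hom}(\mathcal{P}(\phi),\mathcal{P}(\psi))=0$ if $\phi>\psi$; (b) $\mathcal{P}(\phi)[1]=\mathcal{P}(\phi+1)$; (c) every non-zero object $E$ has a Harder--Narasimhan (HN) filtration $0=E_0\to E_1\to\cdots\to E_n=E$ whose successive cones $G_i$ (the HN factors, unique up to isomorphism) are non-zero objects of $\mathcal{P}(\phi_i)$ with $\phi_1>\cdots>\phi_n$; (d) $Z(E)\in\mathbf{R}_{>0}e^{i\pi\phi}$ for every non-zero $E\in\mathcal{P}(\phi)$. For $t\in\mathbf{R}$ the $t$-deformed mass of a non-zero $E$ with HN factors $G_i\in\mathcal{P}(\phi_i)$ is $m^t_\sigma(E)=\sum_i|Z(G_i)|e^{t\phi_i}$, and $m^t_\sigma(0)=0$. For $a\in\mathbf{R}$, $\mathcal{P}(>a)$ (resp. $\mathcal{P}(\le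 a)$) is the full subcategory of objects which are zero or all of whose HN factors have phase $>a$ (resp. $\le a$). These form a t-structure, and each object $E$ sits in a functorial exact triangle $E^{>a}\to E\to E^{\le a}$ with $E^{>a}\in\mathcal{P}(>a)$, $E^{\le a}\in\mathcal{P}(\le a)$. *)

(* Defs.v *)
From HB Require Import structures.
From mathcomp Require Import all_boot all_order all_algebra.
From mathcomp Require Import boolp reals sequences exp trigo.
From mathcomp Require Import complex.
From mathcomp.multinomials Require Import freeg.

Set Implicit Arguments.
Unset Strict Implicit.
Unset Printing Implicit Defensive.

Import Order.TTheory GRing.Theory Num.Theory.

Local Open Scope ring_scope.
Local Open Scope quotient_scope.

Reserved Notation "g \oc f" (at level 40, left associativity).

Record linear_category (k : fieldType) := LinearCategory {
  obj :> Type;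
  hom : obj -> obj -> lmodType k;
  idm : forall X, hom X X;
  comp : forall X Y Z, hom Y Z -> hom X Y -> hom X Z;
  comp_idl : forall X Y (f : hom X Y), comp (idm Y) f = f;
  comp_idr : forall X Y (f : hom X Y), comp f (idm X) = f;
  compA : forall X Y Z W (h : hom Z W) (g : hom Y Z) (f : hom X Y),
    comp h (comp g f) = comp (comp h g) f;
  comp_linearl : forall X Y Z (f : hom X Y), linear (fun g : hom Y Z => comp g f);
  comp_linearr : forall X Y Z (g : hom Y Z), linear (fun f : hom X Y => comp g f)
}.
Arguments hom {k C} : rename.
Arguments idm {k C} X : rename.
Arguments comp {k C X Y Z} g f : rename.
Notation "g \oc f" := (comp g f).

Section LinearCategory.
Context {k : fieldType} {C : linear_category k}.

Definition is_zero (X : C) : Prop :=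
  (forall (Y : C) (f g : hom X Y), f = g) /\
  (forall (Y : C) (f g : hom Y X), f = g).

Definition is_iso (X Y : C) (f : hom X Y) : Prop :=
  exists g : hom Y X, g \oc f = idm X /\ f \oc g = idm Y.

Definition isomorphic (X Y : C) : Prop := exists f : hom X Y, is_iso f.

Definition is_biproduct (X Y S : C) : Prop :=
  exists (i : hom X S) (j : hom Y S) (p : hom S X) (q : hom S Y),
    [/\ p \oc i = idm X, q \oc j = idm Y, p \oc j = 0, q \oc i = 0
      & i \oc p + j \oc q = idm S].

(* A full subcategory is given by its set of objects; following the usual
   convention it is taken closed under isomorphism. *)
Definition additive_subcategory (P : C -> Prop) : Prop :=
  [/\ forall X Y, isomorphic X Y -> P X -> P Y,
      forall X, is_zero X -> P X
    & forall X Y S, is_biproduct X Y S -> P X -> P Y -> P S].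

End LinearCategory.

(* The shift is only required to be an autoequivalence. *)
Record triangulated_category (k : fieldType) := TriangulatedCategory {
  tri_cat :> linear_category k;
  has_zero : exists X : tri_cat, is_zero X;
  has_biproducts : forall X Y : tri_cat, exists S, is_biproduct X Y S;
  shift : tri_cat -> tri_cat;
  shiftm : forall X Y : tri_cat, hom X Y -> hom (shift X) (shift Y);
  shiftm_linear : forall X Y : tri_cat, linear (@shiftm X Y);
  shiftm_id : forall X, shiftm (idm X) = idm (shift X);
  shiftm_comp : forall X Y Z (g : hom Y Z) (f : hom X Y),
    shiftm (g \oc f) = shiftm g \oc shiftm f;
  shiftm_bij : forall X Y, bijective (@shiftm X Y);
  shift_esurj : forall Y, exists X, isomorphic (shift X) Y;
  distinguished : forall X Y Z : tri_cat,
    hom X Y -> hom Y Z -> hom Z (shift X) -> Prop;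
  TR1_iso : forall X Y Z X' Y' Z'
      (f : hom X Y) (g : hom Y Z) (h : hom Z (shift X))
      (f' : hom X' Y') (g' : hom Y' Z') (h' : hom Z' (shift X'))
      (a : hom X X') (b : hom Y Y') (c : hom Z Z'),
    is_iso a -> is_iso b -> is_iso c ->
    b \oc f = f' \oc a -> c \oc g = g' \oc b -> shiftm a \oc h = h' \oc c ->
    distinguished f g h -> distinguished f' g' h';
  TR1_id : forall X Z (g : hom X Z) (h : hom Z (shift X)),
    is_zero Z -> distinguished (idm X) g h;
  TR1_cone : forall X Y (f : hom X Y),
    exists Z (g : hom Y Z) (h : hom Z (shift X)), distinguished f g h;
  TR2 : forall X Y Z (f : hom X Y) (g : hom Y Z) (h : hom Z (shift X)),
    distinguished f g h <-> distinguished g h (- shiftm f);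
  TR3 : forall X Y Z X' Y' Z'
      (f : hom X Y) (g : hom Y Z) (h : hom Z (shift X))
      (f' : hom X' Y') (g' : hom Y' Z') (h' : hom Z' (shift X'))
      (a : hom X X') (b : hom Y Y'),
    distinguished f g h -> distinguished f' g' h' -> b \oc f = f' \oc a ->
    exists c : hom Z Z', c \oc g = g' \oc b /\ shiftm a \oc h = h' \oc c;
  TR4 : forall X Y Z A B M (f : hom X Y) (g : hom Y Z)
      (u : hom Y A) (u' : hom A (shift X))
      (v : hom Z B) (v' : hom B (shift Y))
      (w : hom Z M) (w' : hom M (shift X)),
    distinguished f u u' -> distinguished g v v' ->
    distinguished (g \oc f) w w' ->
    exists (p : hom A M) (q : hom M B),
      [/\ distinguished p q (shiftm u \oc v'), p \oc u = w \oc g,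
          w' \oc p = u', q \oc w = v & v' \oc q = shiftm f \oc w']
}.
Arguments shift {k D} X : rename.
Arguments shiftm {k D X Y} f : rename.
Arguments distinguished {k D X Y Z} f g h : rename.

Definition exact_triangle {k : fieldType} {D : triangulated_category k}
    (X Y Z : D) : Prop :=
  exists (f : hom X Y) (g : hom Y Z) (h : hom Z (shift X)), distinguished f g h.

Section GrothendieckGroup.
Context {k : fieldType} (D : triangulated_category k).

Inductive K0_relation : {freeg {classic D} / int} -> Prop :=
| K0_relation_triangle (X Y Z : D)
    (f : hom X Y) (g : hom Y Z) (h : hom Z (shift X)) :
    distinguished f g h ->
    K0_relation (<< (Y : {classic D}) >> - << (X : {classic D}) >>
                 - << (Z : {classic D}) >>)
| K0_relation0 : K0_relation 0
| K0_relationB x y : K0_relation x -> K0_relation y -> K0_relation (x - y).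

Definition K0_relations : {pred {freeg {classic D} / int}} :=
  fun x => `[< K0_relation x >].

Lemma K0_relations_zmod_closed : zmod_closed K0_relations.
Proof.
split=> [|x y /asboolP Kx /asboolP Ky]; apply/asboolP.
- exact: K0_relation0.
- exact: K0_relationB.
Qed.
HB.instance Definition _ :=
  GRing.isZmodClosed.Build _ K0_relations K0_relations_zmod_closed.

Definition K0 : zmodType := Quotient.quot K0_relations.

Definition K0_class (E : D) : K0 := \pi_(K0) << (E : {classic D}) >>.

End GrothendieckGroup.
Arguments K0_class {k D} E.

Section StabilityConditions.
Context {k : fieldType} {D : triangulated_category k} {R : realType}.

Record HN_filtration (P : R -> D -> Prop) (E : D) := HNFiltration {
  HN_length : nat;
  HN_obj : nat -> D;
  HN_factor : 'I_HN_length -> D;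
  HN_phase : 'I_HN_length -> R;
  HN_obj_first : is_zero (HN_obj 0);
  HN_obj_last : HN_obj HN_length = E;
  HN_triangle : forall i : 'I_HN_length,
    exact_triangle (HN_obj i) (HN_obj i.+1) (HN_factor i);
  HN_factor_neq0 : forall i, ~ is_zero (HN_factor i);
  HN_factor_semistable : forall i, P (HN_phase i) (HN_factor i);
  HN_phase_decr : forall i j : 'I_HN_length, (i < j)%N -> HN_phase j < HN_phase i
}.

Record is_slicing (P : R -> D -> Prop) : Prop := IsSlicing {
  slicing_additive : forall phi, additive_subcategory (P phi);
  slicing_hom0 : forall phi psi E F, psi < phi -> P phi E -> P psi F ->
    forall f : hom E F, f = 0;
  (* P (phi + 1) is the essential image of P phi under the shift. *)
  slicing_shift : forall phi E,
    P (phi + 1) E <-> exists2 F, P phi F & isomorphic (shift F) E;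
  slicing_HN : forall E, ~ is_zero E -> inhabited (HN_filtration P E)
}.

End StabilityConditions.

Record prestability_condition {k : fieldType} (D : triangulated_category k)
    (R : realType) := PrestabilityCondition {
  central_charge : {additive K0 D -> R[i]};
  semistable : R -> D -> Prop;
  semistable_slicing : is_slicing semistable;
  central_charge_phase : forall phi E, semistable phi E -> ~ is_zero E ->
    exists2 r : R, 0 < r
      & central_charge (K0_class E) = r%:C%C * (cos (pi * phi) +i* sin (pi * phi))%C
}.

Section Mass.
Context {k : fieldType} {D : triangulated_category k} {R : realType}.
Variable sigma : prestability_condition D R.

Local Notation P := (semistable sigma).

(* HN filtrations are unique up to isomorphism, so neither the choice made in
   HN nor the existential quantifier in phase_gt and phase_le matters. *)
Definition HN (E : D) (E_neq0 : ~ is_zero E) : HN_filtration P E :=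
  inhabited_witness (slicing_HN (semistable_slicing sigma) E_neq0).

Definition mass (t : R) (E : D) : R :=
  match pselect (is_zero E) with
  | left _ => 0
  | right E_neq0 =>
      let H := HN E_neq0 in
      \sum_(i < HN_length H)
        Normc.normc (central_charge sigma (K0_class (HN_factor i)))
          * expR (t * HN_phase i)
  end.

Definition phase_gt (a : R) (E : D) : Prop :=
  is_zero E \/
  exists H : HN_filtration P E, forall i : 'I_(HN_length H), a < HN_phase i.

Definition phase_le (a : R) (E : D) : Prop :=
  is_zero E \/
  exists H : HN_filtration P E, forall i : 'I_(HN_length H), HN_phase i <= a.

Record truncation (a : R) (E : D) := Truncation {
  truncation_gt : D;
  truncation_le : D;
  truncation_gtP : phase_gt a truncation_gt;
  truncation_leP : phase_le a truncation_le;
  truncation_triangle : exact_triangle truncation_gt E truncation_le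
}.

Lemma triangle_id (X : D) : exists2 Z : D, is_zero Z & exact_triangle X X Z.
Proof.
have [Z Z0] := has_zero D.
by exists Z => //; exists (idm X), 0, 0; exact: TR1_id.
Qed.

Lemma truncation_exists (a : R) (E : D) : inhabited (truncation a E).
Proof.
have [E0|E_neq0] := pselect (is_zero E).
  have [Z Z0 EEZ] := triangle_id E.
  by split; exists E Z => //; left.
have [n F G phi F0 Fn FG G0 GP phiD] := HN E_neq0.
pose Q m := [forall i : 'I_n, (m <= i)%N ==> (phi i <= a)].
have exQ : exists m, Q m.
  by exists n; apply/forallP => i; rewrite [X in X ==> _]leqNgt ltn_ord.
have [j /forallP Qj minj] := ex_minnP exQ.
have phi_le (i : 'I_n) : (j <= i)%N -> phi i <= a.
  by move=> ji; exact: (implyP (Qj i)).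
have phi_gt (i : 'I_n) : (i < j)%N -> a < phi i.
  move=> ij; rewrite ltNge; apply/negP => phia.
  have : Q i.
    apply/forallP => l; apply/implyP; rewrite leq_eqVlt => /orP[/eqP il|il].
      by rewrite -(val_inj il).
    exact: le_trans (ltW (phiD _ _ il)) phia.
  by move=> /minj; rewrite leqNgt ij.
have jn : (j <= n)%N.
  by apply: minj; apply/forallP => i; rewrite [X in X ==> _]leqNgt ltn_ord.
have cones m : (j + m <= n)%N -> exists C : nat -> D,
    [/\ is_zero (C 0%N), exact_triangle (F j) (F (j + m)%N) (C m)
      & forall i : 'I_n, (j <= i)%N -> (i < j + m)%N ->
        exact_triangle (C (i - j)%N) (C (i - j).+1) (G i)].
  elim: m => [_|m IHm].
    have [Z Z0 FFZ] := triangle_id (F j).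
    exists (fun=> Z); rewrite addn0; split=> // i ji ij.
    by move: ij; rewrite ltnNge ji.
  rewrite addnS => jmn; have [C [C0 [f [u [u' fuu']]] CG]] := IHm (ltnW jmn).
  have [g [v [v' gvv']]] := FG (Ordinal jmn).
  have [M [w [w' gfww']]] := TR1_cone (g \oc f).
  have [p [q [pqr _ _ _ _]]] := TR4 fuu' gvv' gfww'.
  exists (fun i => if (i <= m)%N then C i else M); rewrite ltnn; split=> //.
    by exists (g \oc f), w, w'.
  move=> i ji; rewrite ltnS leq_eqVlt => /orP[/eqP ijm|ijm].
    have -> : i = Ordinal jmn by apply: val_inj.
    by rewrite /= addKn leqnn ltnn; exists p, q, (shiftm u \oc v').
  have ijm' : (i - j < m)%N by rewrite ltn_subLR.
  by rewrite (ltnW ijm') ijm'; exact: CG.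
have [C [C0 tri CG]] := cones (n - j)%N (leq_trans (eq_leq (subnKC jn)) (leqnn n)).
rewrite subnKC // Fn in tri CG.
split; exists (F j) (C (n - j)%N) => //; right.
- exists (@HNFiltration _ _ _ P (F j) j F (fun i => G (widen_ord jn i))
    (fun i => phi (widen_ord jn i)) F0 erefl (fun i => FG (widen_ord jn i))
    (fun i => G0 _) (fun i => GP _) (fun i l => @phiD (widen_ord jn i) (widen_ord jn l))).
  by move=> /= i; apply: phi_gt; exact: (ltn_ord i).
- have lt_n (i : 'I_(n - j)) : (j + i < n)%N by rewrite -ltn_subRL.
  pose s i := Ordinal (lt_n i).
  have CGs (i : 'I_(n - j)) : exact_triangle (C i) (C i.+1) (G (s i)).
    by have := CG (s i) (leq_addr _ _) (ltn_ord _); rewrite /= addKn.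
  have sD (i l : 'I_(n - j)) : (i < l)%N -> phi (s l) < phi (s i).
    by move=> il; apply: phiD; rewrite /= ltn_add2l.
  exists (@HNFiltration _ _ _ P (C (n - j)%N) (n - j)%N C (fun i => G (s i))
    (fun i => phi (s i)) C0 erefl CGs (fun i => G0 _) (fun i => GP _) sD).
  by move=> /= i; apply: phi_le; exact: leq_addr.
Qed.

(* Truncation triangles are unique up to isomorphism; trunc_gt a E and
   trunc_le a E are the outer terms of a chosen one. *)
Definition trunc (a : R) (E : D) : truncation a E :=
  inhabited_witness (truncation_exists a E).

Definition trunc_gt (a : R) (E : D) : D := truncation_gt (trunc a E).

Definition trunc_le (a : R) (E : D) : D := truncation_le (trunc a E).

End Mass.

(* Main.v *)
From HB Require Import structures.
From mathcomp Require Import all_boot all_order all_algebra.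
From mathcomp Require Import boolp classical_sets functions reals ereal.
From mathcomp Require Import topology normedtype sequences derive realfun exp.
From mathcomp Require Import trigo measure measurable_realfun lebesgue_measure.
From mathcomp Require Import lebesgue_integral ftc.
From mathcomp Require Import ring lra complex.
From mathcomp.multinomials Require Import freeg.
Require Import Defs.

(* For a slicing P and a real c, put v_c(E) = Im (exp(- i pi c) Z(H)), where H
   is the cohomology of E in the heart P((c, c + 1]). This functional is
   nonnegative on the heart, so the long exact cohomology sequence makes v_c
   subadditive on exact triangles. If E has HN factors of phases phi_i and
   absolute charges r_i, then v_c(E) is the sum of the r_i s(phi_i - c), where
   s(x) = sin(pi x) on (0, 1) and 0 elsewhere. Hence the integral of
   exp(t c) v_c(E) over c is a positive multiple, independent of E, of the
   t-deformed mass of E, and the mass is subadditive. This holds for arbitrary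
   choices of HN filtrations, so it also shows that the mass does not depend on
   the choice. The same argument gives equality for E in P(>a), G in P(<=a).

   For the upper bound, there are objects C, L, J with exact triangles
     E^{>a} -> F^{>a} -> C,  F^{<=a} -> G^{<=a} -> J,
     C[1] -> L -> J,  E^{<=a}[1] -> L -> G^{>a}[1],
   where C is in P(>a) and J in P(<= a + 1). Subadditivity applied to rotations
   of these triangles bounds the masses of E^{>a} and G^{<=a}, up to the error
   terms m(C) and m(J), which satisfy
   e^t m(C) + m(J) = m(L) <= e^t (m(E^{<=a}) + m(G^{>a})). *)

Set Implicit Arguments.
Unset Strict Implicit.
Unset Printing Implicit Defensive.

Import Order.TTheory GRing.Theory Num.Theory.
Import numFieldNormedType.Exports.

Local Open Scope ring_scope.

(** * The sine bump and its exponential transform *)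

Definition sin_bump {R : realType} (x : R) : R :=
  if 0 < x < 1 then sin (pi * x) else 0.

Section SinBump.
Context {R : realType}.
Implicit Types (t c phi : R).

Lemma sin_bump_ge0 (x : R) : 0 <= sin_bump x.
Proof.
rewrite /sin_bump; case: ifP => // /andP[x0 x1].
apply: sin_ge0_pi; rewrite mulr_ge0 ?pi_ge0 ?(ltW x0)//=.
by rewrite ler_piMr ?pi_ge0 ?ltW.
Qed.

(** An antiderivative in [c] of [expR (t * c) * sin (pi * (phi - c))], found by integrating by parts
    twice; since [pi] is positive, the denominator is nonzero for every real [t]. *)
Definition sin_bump_primitive t phi c : R :=
  (t ^+ 2 + pi ^+ 2)^-1 * (expR (t * c) *
    (t * sin (pi * (phi - c)) + pi * cos (pi * (phi - c)))).

Lemma sin_bump_primitive_derive t phi c :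
  is_derive c 1 (sin_bump_primitive t phi) (expR (t * c) * sin (pi * (phi - c))).
Proof.
have nz : t ^+ 2 + pi ^+ 2 != 0 :> R.
  by rewrite gt_eqF // ltr_wpDl ?sqr_ge0 ?exprn_gt0 ?pi_gt0.
rewrite /sin_bump_primitive; apply: is_derive_eq; rewrite /GRing.scale /=.
by move: nz; move: (pi : R) => p nz; field.
Qed.

Lemma sin_bump_integrand t phi :
  (fun c => (expR (t * c) * sin_bump (phi - c))%:E) =
  (fun c => (expR (t * c) * sin (pi * (phi - c)))%:E) \_ `]phi - 1, phi[%classic.
Proof.
apply/funext => c; rewrite /sin_bump patchE; case: ifPn.
  move=> /andP[c0 c1]; rewrite mem_set //= in_itv /=; apply/andP; split; lra.
move=> cN; rewrite memNset ?mulr0 //= in_itv /= => /andP[c0 c1].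
by case/negP: cN; apply/andP; split; lra.
Qed.

Let continuous_integrand t phi :
  continuous (fun c => expR (t * c) * sin (pi * (phi - c)) : R^o).
Proof.
move=> c; apply/differentiable_continuous/derivable1_diffP.
exact: ex_derive.
Qed.

Let measurable_integrand t phi :
  measurable_fun setT (fun c => (expR (t * c) * sin (pi * (phi - c)))%:E).
Proof.
have := continuous_measurable_fun (@continuous_integrand t phi).
by move=> /measurable_EFinP.
Qed.

Lemma measurable_sin_bump_integrand t phi :
  measurable_fun setT (fun c => (expR (t * c) * sin_bump (phi - c))%:E).
Proof.
rewrite sin_bump_integrand; apply: (measurable_restrictT _ _).1 => //.
exact: measurable_funTS (measurable_integrand t phi).
Qed.

Lemma integral_sin_bump t phi :
  (\int[lebesgue_measure]_c (expR (t * c) * sin_bump (phi - c))%:E =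
   (pi * (1 + expR (- t)) / (t ^+ 2 + pi ^+ 2) * expR (t * phi))%:E)%E.
Proof.
rewrite sin_bump_integrand -integral_mkcond.
(* Adding the two endpoints leaves the integral unchanged and gives the closed interval needed for
   the fundamental theorem of calculus. *)
rewrite -(@integral_itv_bndoo _ (phi - 1) phi _ true false); last first.
  exact: measurable_funTS (measurable_integrand t phi).
have dF c : derivable (sin_bump_primitive t phi : R -> R^o) c 1.
  by have [] := sin_bump_primitive_derive t phi c.
have cF c : {for c, continuous (sin_bump_primitive t phi : R -> R^o)}.
  exact/differentiable_continuous/derivable1_diffP.
rewrite (@continuous_FTC2 _ _ (sin_bump_primitive t phi)).
- have d1 : phi - (phi - 1) = 1 by ring.
  rewrite /sin_bump_primitive d1 subrr mulr0 sin0 cos0 mulr1 sinpi cospi.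
  rewrite mulrBr mulr1 expRD -EFinB; congr EFin; ring.
- lra.
- exact: continuous_subspaceT.
- split=> [c _ //||]; [apply: cvg_at_right_filter|apply: cvg_at_left_filter]; exact: cF.
- move=> c _; rewrite derive1E.
  exact: (derive_val (is_derive:=sin_bump_primitive_derive t phi c)).
Qed.

(** Multiply the bump inequality by the positive weight [expR (t * c)] and integrate over [c]. A
    bump of phase [phi] yields [expR (t * phi)] times a positive constant independent of [phi],
    which cancels. *)
Lemma sum_expR_le_of_sin_bump (I J : finType) (r phi : I -> R)
    (s psi : J -> R) t :
  (forall i, 0 <= r i) -> (forall j, 0 <= s j) ->
  (forall c, \sum_i r i * sin_bump (phi i - c)
             <= \sum_j s j * sin_bump (psi j - c)) ->
  \sum_i r i * expR (t * phi i) <= \sum_j s j * expR (t * psi j).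
Proof.
move=> r0 s0 rs.
pose K : R := pi * (1 + expR (- t)) / (t ^+ 2 + pi ^+ 2).
have K0 : 0 < K.
  rewrite /K divr_gt0 //; first by rewrite mulr_gt0 ?pi_gt0 // addr_gt0 ?expR_gt0.
  by rewrite ltr_wpDl ?sqr_ge0 ?exprn_gt0 ?pi_gt0.
pose u (L : finType) (q chi : L -> R) c := (\sum_l q l * sin_bump (chi l - c)).
have integrand (L : finType) (q chi : L -> R) c :
    (expR (t * c) * u L q chi c)%:E =
    (\sum_l (q l)%:E * (expR (t * c) * sin_bump (chi l - c))%:E)%E.
  rewrite mulr_sumr -sumEFin; apply: eq_bigr => l _.
  by rewrite -EFinM mulrCA.
have mL (L : finType) (q chi : L -> R) l : measurable_fun setT
    (fun c => ((q l)%:E * (expR (t * c) * sin_bump (chi l - c))%:E)%E).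
  by apply: measurable_funeM; exact: measurable_sin_bump_integrand.
have intL (L : finType) (q chi : L -> R) : (forall l, 0 <= q l) ->
    (\int[lebesgue_measure]_c (expR (t * c) * u L q chi c)%:E =
     (K * \sum_l q l * expR (t * chi l))%:E)%E.
  move=> q0; under eq_integral do rewrite integrand.
  rewrite ge0_integral_sum //; [|exact: mL|]; last first.
    by move=> l c _; rewrite -EFinM lee_fin !mulr_ge0 ?expR_ge0 ?sin_bump_ge0.
  rewrite mulr_sumr -sumEFin; apply: eq_bigr => l _.
  rewrite ge0_integralZl ?lee_fin //.
  - by rewrite integral_sin_bump -EFinM mulrCA.
  - exact: measurable_sin_bump_integrand.
  - by move=> c _; rewrite lee_fin mulr_ge0 ?expR_ge0 ?sin_bump_ge0.
have muL (L : finType) (q chi : L -> R) :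
    measurable_fun setT (fun c => (expR (t * c) * u L q chi c)%:E).
  rewrite (_ : (fun _ => _) = fun c =>
      (\sum_l (q l)%:E * (expR (t * c) * sin_bump (chi l - c))%:E)%E).
    by apply: emeasurable_sum => l; exact: mL.
  by apply/funext => c; rewrite integrand.
rewrite -(ler_pM2l K0) -lee_fin -!intL //.
apply: ge0_le_integral => //.
- move=> c _; rewrite lee_fin mulr_ge0 ?expR_ge0 // sumr_ge0 // => i _.
  by rewrite mulr_ge0 ?sin_bump_ge0.
- exact: muL.
- exact: muL.
- by move=> c _; rewrite lee_fin ler_wpM2l ?expR_ge0 //; exact: rs.
Qed.
End SinBump.

(** * Triangulated categories *)

Section Triangles.
Context {k : fieldType} {D : triangulated_category k}.
Implicit Types W X Y Z : D.

Lemma comp0m X Y Z (f : hom X Y) : (0 : hom Y Z) \oc f = 0.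
Proof.
have := comp_linearl f 1 (0 : hom Y Z) 0; rewrite !scale1r addr0 => e.
by apply: (addrI (0 \oc f)); rewrite addr0 -e.
Qed.

Lemma compm0 X Y Z (g : hom Y Z) : g \oc (0 : hom X Y) = 0.
Proof.
have := comp_linearr g 1 (0 : hom X Y) 0; rewrite !scale1r addr0 => e.
by apply: (addrI (g \oc 0)); rewrite addr0 -e.
Qed.

Lemma compNm X Y Z (g : hom Y Z) (f : hom X Y) : (- g) \oc f = - (g \oc f).
Proof.
have := comp_linearl f (-1) g 0.
by rewrite !scaleN1r !addr0 comp0m addr0.
Qed.

Lemma compmN X Y Z (g : hom Y Z) (f : hom X Y) : g \oc (- f) = - (g \oc f).
Proof.
have := comp_linearr g (-1) f 0.
by rewrite !scaleN1r !addr0 compm0 addr0.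
Qed.

Lemma shiftm0 X Y : shiftm (0 : hom X Y) = 0.
Proof.
have := @shiftm_linear _ D X Y 1 0 0; rewrite !scale1r addr0 => e.
by apply: (addrI (shiftm (0 : hom X Y))); rewrite addr0 -e.
Qed.

Lemma shiftm_inj X Y : injective (@shiftm k D X Y).
Proof. exact: bij_inj (shiftm_bij X Y). Qed.

Lemma shiftm_surj X Y (g : hom (shift X) (shift Y)) : exists f, g = shiftm f.
Proof. by have [h _ hK] := shiftm_bij X Y; exists (h g); rewrite hK. Qed.

Lemma is_zero_idm X : idm X = 0 -> is_zero X.
Proof.
move=> X0; split=> Y f g.
  by rewrite -[f]comp_idr -[g]comp_idr X0 !compm0.
by rewrite -[f]comp_idl -[g]comp_idl X0 !comp0m.
Qed.

Lemma is_zero_shift X : is_zero X -> is_zero (shift X).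
Proof.
move=> X0; apply: is_zero_idm.
by rewrite -shiftm_id (X0.1 _ (idm X) 0) shiftm0.
Qed.

Lemma is_zero_unshift X : is_zero (shift X) -> is_zero X.
Proof.
move=> X0; apply: is_zero_idm; apply: shiftm_inj.
exact: X0.1.
Qed.

(** Exactness of Hom(-, W) at Y: [TR3] extends [u] to a morphism into the triangle 0 -> W -> W. *)
Lemma factor_third X Y Z (f : hom X Y) (g : hom Y Z) (h : hom Z (shift X)) W
    (u : hom Y W) :
  distinguished f g h -> u \oc f = 0 -> exists v : hom Z W, u = v \oc g.
Proof.
move=> fgh uf0; have [O O0] := has_zero D.
have dW : distinguished (0 : hom O W) (idm W) 0.
  by apply/TR2; apply: TR1_id; exact: is_zero_shift.
have [|v [vg _]] := TR3 (a := 0) (b := u) fgh dW; first by rewrite uf0 comp0m.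
by exists v; rewrite vg comp_idl.
Qed.

(** Exactness of Hom(W, -) at Y. Since [TR3] produces the third map of a morphism of triangles, both
    triangles are rotated first: this gives the shift of [v], and the two rotation signs cancel. *)
Lemma lift_first X Y Z (f : hom X Y) (g : hom Y Z) (h : hom Z (shift X)) W
    (u : hom W Y) :
  distinguished f g h -> g \oc u = 0 -> exists v : hom W X, u = f \oc v.
Proof.
move=> fgh gu0; have [O O0] := has_zero D.
have dW : distinguished (0 : hom W O) (0 : hom O (shift W)) (- shiftm (idm W)).
  by apply: (TR2 _ _ _).1; exact: TR1_id.
have /TR2 fgh' := fgh.
have [|w [_ uw]] := TR3 (a := u) (b := 0) dW fgh'; first by rewrite gu0 compm0.
have [v vw] := shiftm_surj w; exists v; apply: shiftm_inj; apply: oppr_inj.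
move: uw; rewrite shiftm_id compmN comp_idr => ->.
by rewrite vw compNm shiftm_comp.
Qed.

Lemma exact_rotate X Y Z : exact_triangle X Y Z -> exact_triangle Y Z (shift X).
Proof. by move=> [f [g [h /TR2 fgh]]]; exists g, h, (- shiftm f). Qed.

Lemma exact_shift X Y Z :
  exact_triangle X Y Z -> exact_triangle (shift X) (shift Y) (shift Z).
Proof. by move=> XYZ; do 3 apply: exact_rotate. Qed.

Lemma exact_octahedron X Y Z A B :
  exact_triangle X Y A -> exact_triangle Y Z B ->
  exists2 M, exact_triangle X Z M & exact_triangle A M B.
Proof.
move=> [f [u [u' fuu']]] [g [v [v' gvv']]].
have [M [w [w' gfww']]] := TR1_cone (g \oc f).
have [p [q [pq _ _ _ _]]] := TR4 fuu' gvv' gfww'.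
by exists M; [exists (g \oc f), w, w' | exists p, q, (shiftm u \oc v')].
Qed.

Lemma K0_class_exact X Y Z :
  exact_triangle X Y Z -> K0_class Y = K0_class X + K0_class Z.
Proof.
move=> [f [g [h fgh]]].
rewrite /K0_class -[X in _ = X]raddfD.
apply/eqP; rewrite -Quotient.idealrBE opprD addrA.
by apply/asboolP; exact: (K0_relation_triangle fgh).
Qed.

Lemma K0_class_zero X : is_zero X -> K0_class X = 0.
Proof.
move=> X0; have /K0_class_exact : exact_triangle X X X.
  by exists (idm X), 0, 0; apply: TR1_id.
by move=> e; apply: (addrI (K0_class X)); rewrite addr0 -e.
Qed.

Lemma exact_zero_third X Z : is_zero Z -> exact_triangle X X Z.
Proof. by move=> Z0; exists (idm X), 0, 0; exact: TR1_id. Qed.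

Lemma exact_zero_mid X Z : is_zero Z -> exact_triangle X Z (shift X).
Proof. by move/(exact_zero_third X)/exact_rotate. Qed.

Lemma K0_class_shift X : K0_class (shift X) = - K0_class X.
Proof.
have [O O0] := has_zero D.
have /K0_class_exact := exact_zero_mid X O0.
by rewrite (K0_class_zero O0) => /eqP; rewrite eq_sym addrC addr_eq0 => /eqP.
Qed.

End Triangles.

(** * Truncations for a slicing *)

Section Slicing.
Context {k : fieldType} {D : triangulated_category k} {R : realType}.
Variable P : R -> D -> Prop.
Hypothesis slP : is_slicing P.
Implicit Types (a b c : R) (E F G X Y Z : D).

(** Membership in P(>a) expressed by orthogonality, so that closure under extensions and shifts
    follows from exactness of Hom. Agreement with the description by HN phases is [HN_phase_gt] and
    [phase_gt_hom_gt]; [hom_le] is dual. *)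
Definition hom_gt a X :=
  forall phi Y, phi <= a -> P phi Y -> forall f : hom X Y, f = 0.

Definition hom_le a X :=
  forall phi Y, a < phi -> P phi Y -> forall f : hom Y X, f = 0.

Lemma hom_gt_zero a X : is_zero X -> hom_gt a X.
Proof. by move=> X0 phi Y _ _ f; exact: X0.1. Qed.

Lemma hom_le_zero a X : is_zero X -> hom_le a X.
Proof. by move=> X0 phi Y _ _ f; exact: X0.2. Qed.

Lemma hom_gtW a b X : a <= b -> hom_gt b X -> hom_gt a X.
Proof. by move=> ab Xb phi Y phia; apply: Xb; exact: le_trans ab. Qed.

Lemma hom_leW a b X : a <= b -> hom_le a X -> hom_le b X.
Proof. by move=> ab Xa phi Y phib; apply: Xa; exact: le_lt_trans phib. Qed.

Lemma hom_gt_semistable a phi X : a < phi -> P phi X -> hom_gt a X.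
Proof.
move=> aphi PX psi Y psia PY; apply: (slicing_hom0 slP _ PX PY).
exact: le_lt_trans aphi.
Qed.

Lemma hom_le_semistable a phi X : phi <= a -> P phi X -> hom_le a X.
Proof.
move=> aphi PX psi Y psia PY; apply: (slicing_hom0 slP _ PY PX).
exact: le_lt_trans psia.
Qed.

Lemma hom_gt_ext a X Y Z :
  exact_triangle X Y Z -> hom_gt a X -> hom_gt a Z -> hom_gt a Y.
Proof.
move=> [f [g [h fgh]]] Xa Za phi W phia PW u.
have [v ->] := factor_third fgh (Xa _ _ phia PW (u \oc f)).
by rewrite (Za _ _ phia PW v) comp0m.
Qed.

Lemma hom_le_ext a X Y Z :
  exact_triangle X Y Z -> hom_le a X -> hom_le a Z -> hom_le a Y.
Proof.
move=> [f [g [h fgh]]] Xa Za phi W phia PW u.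
have [v ->] := lift_first fgh (Za _ _ phia PW (g \oc u)).
by rewrite (Xa _ _ phia PW v) compm0.
Qed.

Lemma semistable_shift phi X : P phi X -> P (phi + 1) (shift X).
Proof.
move=> PX; apply/(slicing_shift slP); exists X => //.
by exists (idm _), (idm _); rewrite comp_idl.
Qed.

Lemma semistable_unshift phi Y : P phi Y ->
  exists X (e : hom (shift X) Y), P (phi - 1) X /\ is_iso e.
Proof.
rewrite -{1}(subrK 1 phi) => /(slicing_shift slP)[X PX [e eiso]].
by exists X, e.
Qed.

Lemma hom_gt_shift a X : hom_gt a X -> hom_gt (a + 1) (shift X).
Proof.
move=> Xa phi Y phia PY f.
have [W [e [PW [e' [_ ee']]]]] := semistable_unshift PY.
have [g ge] := shiftm_surj (e' \oc f).
have g0 : g = 0 by apply: (Xa _ _ _ PW); lra.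
by rewrite -[f]comp_idl -ee' -compA ge g0 shiftm0 compm0.
Qed.

Lemma hom_le_shift a X : hom_le a X -> hom_le (a + 1) (shift X).
Proof.
move=> Xa phi Y phia PY f.
have [W [e [PW [e' [_ ee']]]]] := semistable_unshift PY.
have [g ge] := shiftm_surj (f \oc e).
have g0 : g = 0 by apply: (Xa _ _ _ PW); lra.
by rewrite -[f]comp_idr -ee' compA ge g0 shiftm0 comp0m.
Qed.

Lemma hom_le_unshift a X : hom_le (a + 1) (shift X) -> hom_le a X.
Proof.
move=> Xa phi Y phia PY f; apply: shiftm_inj; rewrite shiftm0.
by apply: (Xa _ _ _ (semistable_shift PY)); rewrite ltrD2r.
Qed.

(** Rotation makes Z an extension of X[1] by Y, and the shift raises the phase bound of X by one. *)
Lemma hom_gt_third a X Y Z :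
  exact_triangle X Y Z -> hom_gt (a - 1) X -> hom_gt a Y -> hom_gt a Z.
Proof.
move=> /exact_rotate YZX Xa Ya; apply: hom_gt_ext YZX Ya _.
by rewrite -(subrK 1 a); exact: hom_gt_shift.
Qed.

Lemma hom_le_third a X Y Z :
  exact_triangle X Y Z -> hom_le (a - 1) X -> hom_le a Y -> hom_le a Z.
Proof.
move=> /exact_rotate YZX Xa Ya; apply: hom_le_ext YZX Ya _.
by rewrite -(subrK 1 a); exact: hom_le_shift.
Qed.

(** Rotating twice places X[1] between Z and Y[1]; the bound obtained for X[1] is then shifted
    back. *)
Lemma hom_le_first a X Y Z :
  exact_triangle X Y Z -> hom_le a Y -> hom_le (a + 1) Z -> hom_le a X.
Proof.
move=> /exact_rotate/exact_rotate ZXY Ya Za; apply: hom_le_unshift.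
by apply: hom_le_ext ZXY Za _; exact: hom_le_shift.
Qed.

(** * HN filtrations and their truncations *)

Section HN.
Variables (E : D) (H : HN_filtration P E).
Local Notation n := (HN_length H).

Lemma HN_obj_gt a j : (j <= n)%N ->
  (forall i : 'I_n, (i < j)%N -> a < HN_phase i) -> hom_gt a (HN_obj H j).
Proof.
elim: j => [_ _|j IHj jn phia].
  by apply: hom_gt_zero; exact: HN_obj_first.
apply: hom_gt_ext (HN_triangle (Ordinal jn)) (IHj (ltnW jn) _) _ => /=.
  by move=> i ij; apply: phia; exact: ltnW.
by apply: hom_gt_semistable (HN_factor_semistable _); exact: phia.
Qed.

Lemma K0_class_HN_obj j : (j <= n)%N ->
  K0_class (HN_obj H j) = \sum_(i < n | (i < j)%N) K0_class (HN_factor i).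
Proof.
elim: j => [_|j IHj jn].
  by rewrite big_pred0 ?K0_class_zero//; exact: HN_obj_first.
rewrite (K0_class_exact (HN_triangle (Ordinal jn))) IHj 1?ltnW//.
rewrite [RHS](bigD1 (Ordinal jn)) //= addrC; congr (_ + _).
by apply: eq_bigl => i; rewrite -val_eqE /= ltnS ltn_neqAle andbC.
Qed.

(** The truncation is built along the filtration so that the class of X in the Grothendieck group
    can be read off from the factors. *)
Lemma HN_truncation c : exists X Y,
  [/\ exact_triangle X E Y, hom_gt c X, hom_le c Y
    & K0_class X = \sum_(i < n | c < HN_phase i) K0_class (HN_factor i)].
Proof.
have [O O0] := has_zero D.
suff /(_ n (leqnn n)) [X [Y []]] : forall j, (j <= n)%N -> exists X Y,
    [/\ exact_triangle X (HN_obj H j) Y, hom_gt c X, hom_le c Y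
    & K0_class X = \sum_(i < n | (i < j)%N && (c < HN_phase i))
        K0_class (HN_factor i)].
  rewrite HN_obj_last => XEY Xc Yc XK; exists X, Y; split=> //.
  by rewrite XK; apply: eq_bigl => i; rewrite ltn_ord.
elim=> [_|j IHj jn].
  exists (HN_obj H 0), O; split; first exact: exact_zero_third.
  - by apply: hom_gt_zero; exact: HN_obj_first.
  - exact: hom_le_zero.
  - by rewrite big_pred0 ?K0_class_zero //; exact: HN_obj_first.
(* Phases decrease: if the new factor has phase above [c], so do all earlier ones and the whole step
   is X. Otherwise the octahedral axiom adds the factor to Y. *)
have [cj|jc] := ltP c (HN_phase (Ordinal jn)).
  have gtc (i : 'I_n) : (i < j.+1)%N -> c < HN_phase i.
    rewrite ltnS leq_eqVlt => /orP[/eqP ij|ij].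
      by have -> : i = Ordinal jn by exact: val_inj.
    exact: lt_trans cj (HN_phase_decr (j := Ordinal jn) ij).
  exists (HN_obj H j.+1), O; split; first exact: exact_zero_third.
  - exact: HN_obj_gt.
  - exact: hom_le_zero.
  - rewrite K0_class_HN_obj //; apply: eq_bigl => i.
    by have [/gtc ->|] := boolP (i < j.+1)%N.
have [X [Y [XEY Xc Yc XK]]] := IHj (ltnW jn).
have [M XM YM] := exact_octahedron XEY (HN_triangle (Ordinal jn)).
exists X, M; split=> //.
  apply: hom_le_ext YM Yc _.
  exact: hom_le_semistable jc (HN_factor_semistable _).
rewrite XK; apply: eq_bigl => i; rewrite ltnS [in RHS]leq_eqVlt.
have [ij|] //= := eqVneq (i : nat) j.
have -> : i = Ordinal jn by exact: val_inj.
by rewrite /= ltnn ltNge jc.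
Qed.

Lemma HN_phase_gt a : hom_gt a E -> forall i : 'I_n, a < HN_phase i.
Proof.
move=> Ea i; have n0 : (0 < n)%N by exact: leq_ltn_trans (ltn_ord i).
have ln : (n.-1 < n)%N by rewrite prednK.
pose l := Ordinal ln.
have phil (j : 'I_n) : (j < n.-1)%N -> HN_phase l < HN_phase j.
  by move=> jl; exact: (HN_phase_decr (j := l)).
suff al : a < HN_phase l.
  have : (i <= n.-1)%N by rewrite -ltnS prednK.
  rewrite leq_eqVlt => /orP[/eqP il|/phil]; last exact: lt_trans.
  by have -> : i = l by exact: val_inj.
rewrite ltNge; apply/negP => la; apply: (HN_factor_neq0 (i := l)).
apply: is_zero_idm.
(* The last factor has the smallest phase. If that phase were at most [a], the factor would be
   orthogonal to its own phase, so its identity would vanish. *)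
have : hom_gt (HN_phase l) (HN_factor l).
  apply: hom_gt_third (HN_triangle l) _ _ => /=.
    apply: (@hom_gtW _ (HN_phase l)); first lra.
    by apply: HN_obj_gt (ltnW ln) _.
  by rewrite prednK // HN_obj_last; exact: hom_gtW Ea.
by apply; [exact: lexx | exact: HN_factor_semistable].
Qed.

Lemma HN_phase_le a : hom_le a E -> forall i : 'I_n, HN_phase i <= a.
Proof.
move=> Ea i; have n0 : (0 < n)%N by exact: leq_ltn_trans (ltn_ord i).
pose o := Ordinal n0.
have phio (j : 'I_n) : HN_phase j <= HN_phase o.
  have := leq0n j; rewrite leq_eqVlt => /orP[/eqP oj|oj].
    by have -> : j = o by exact: val_inj.
  by apply/ltW; exact: (HN_phase_decr (i := o)).
suff oa : HN_phase o <= a by exact: le_trans oa.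
rewrite leNgt; apply/negP => ao; apply: (HN_factor_neq0 (i := o)).
apply: is_zero_idm.
(* Chosen so that a <= b < [HN_phase o] <= b + 1. Since all factors have phase at most b + 1, the
   bound [b] descends from E through the filtration to its first step, hence to the first factor,
   whose phase exceeds [b]. *)
pose b := Num.max a (HN_phase o - 1).
have bo : b < HN_phase o by rewrite gt_max ao /=; lra.
have ob : HN_phase o <= b + 1 by rewrite -lerBlDr le_max lexx orbT.
have Fb j : (j <= n)%N -> hom_le b (HN_obj H (n - j)).
  elim: j => [_|j IHj jn].
    by rewrite subn0 HN_obj_last; apply: hom_leW Ea; rewrite le_max lexx.
  have ltn : (n - j.+1 < n)%N by rewrite ltn_subrL n0.
  apply: hom_le_first (HN_triangle (Ordinal ltn)) _ _ => /=.
    by rewrite -subSn // subSS; apply: IHj; exact: ltnW.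
  by apply: hom_le_semistable (HN_factor_semistable _); exact: le_trans ob.
have : hom_le b (HN_factor o).
  apply: hom_le_third (HN_triangle o) _ _ => /=.
    by apply: hom_le_zero; exact: HN_obj_first.
  by have := Fb n.-1 (leq_pred n); rewrite -subn1 subKn.
by apply; [exact: bo | exact: HN_factor_semistable].
Qed.

End HN.

(** A zero object gets the filtration of length zero, which spares later arguments a case
    distinction. *)
Lemma HN_filtration_exists E : inhabited (HN_filtration P E).
Proof.
have [E0|] := pselect (is_zero E); last exact: (slicing_HN slP).
have no (i : 'I_0) : False by case: i.
split; exact: (@HNFiltration _ _ _ P E 0 (fun=> E) (fun=> E) (fun=> 0) E0 erefl
  (fun i => False_ind _ (no i)) (fun i => False_ind _ (no i))
  (fun i => False_ind _ (no i)) (fun i => False_ind _ (no i))).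
Qed.

Lemma hom_gt_le_zero a X : hom_gt a X -> hom_le a X -> is_zero X.
Proof.
move=> Xgt Xle; have [H] := HN_filtration_exists X.
case n0 : (HN_length H) => [|n].
  by have := HN_obj_first H; rewrite -n0 HN_obj_last.
have i : 'I_(HN_length H) by rewrite n0; exact: ord0.
by have := HN_phase_gt Xgt i; rewrite ltNge HN_phase_le.
Qed.

Lemma hom_gt_le_hom0 a X Y :
  hom_gt a X -> hom_le a Y -> forall f : hom X Y, f = 0.
Proof.
move=> Xa Ya; have [H] := HN_filtration_exists X.
rewrite -(HN_obj_last H).
elim: {-2}(HN_length H) (leqnn (HN_length H)) => [_ f|j IHj jn u].
  exact: (HN_obj_first H).1.
have [f [g [h fgh]]] := HN_triangle (Ordinal jn).
have [v ->] := factor_third fgh (IHj (ltnW jn) (u \oc f)).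
rewrite (Ya _ _ _ (HN_factor_semistable (Ordinal jn)) v) ?comp0m //.
exact: HN_phase_gt.
Qed.

(* Compare F with the truncations of E and G through N = cone(E^{>c} -> F) and
   L = cone(N -> G -> G^{<=c}). *)
Lemma truncation_exact c E F G Egt Ele Fgt Fle Ggt Gle :
  exact_triangle E F G -> exact_triangle Egt E Ele ->
  exact_triangle Fgt F Fle -> exact_triangle Ggt G Gle ->
  hom_gt c Egt -> hom_gt c Fgt -> hom_le c Fle -> hom_le c Gle ->
  exists C L J, [/\ exact_triangle Egt Fgt C, exact_triangle Fle Gle J,
    exact_triangle (shift C) L J & exact_triangle (shift Ele) L (shift Ggt)].
Proof.
move=> [f [g [h fgh]]] [e1 [e2 [e3 dE]]] [f1 [f2 [f3 dF]]] [g1 [g2 [g3 dG]]].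
move=> Egtc Fgtc Flec Glec.
have [s sE] := lift_first dF (hom_gt_le_hom0 Egtc Flec (f2 \oc (f \oc e1))).
have [N [w [w' dN]]] := TR1_cone (f \oc e1).
(* N is the cone of one map E^{>c} -> F, factored through E and through F^{>c}. The two octahedra
   give E^{<=c} -> N -> G and C -> N -> F^{<=c}. *)
have [p [q [dpq _ _ _ _]]] := TR4 dE fgh dN.
have [C [r [r' dC]]] := TR1_cone s.
rewrite sE in dN.
have [p2 [q2 [dpq2 _ _ _ _]]] := TR4 dC dF dN.
have Cc : hom_gt c C.
  apply: (@hom_gt_third c Egt Fgt C) => //; first by exists s, r, r'.
  by apply: hom_gtW Egtc; lra.
have [s2 s2E] := factor_third dpq2
  (hom_gt_le_hom0 Cc Glec ((g2 \oc q) \oc p2)).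
have [J [u [u' dJ]]] := TR1_cone s2.
have [L [v [v' dL]]] := TR1_cone (s2 \oc q2).
(* Likewise the map N -> G^{<=c} factors through F^{<=c} and through G, which gives the two
   triangles containing L. *)
have /TR2 dpq2' := dpq2; have [p3 [q3 [dL1 _ _ _ _]]] := TR4 dpq2' dJ dL.
rewrite -s2E in dL; have /TR2 dpq' := dpq; have /TR2 dG' := dG.
have [p4 [q4 [dL2 _ _ _ _]]] := TR4 dpq' dG' dL.
exists C, L, J; split.
- by exists s, r, r'.
- by exists s2, u, u'.
- by do 3 eexists; exact: dL1.
- by do 3 eexists; exact: dL2.
Qed.

End Slicing.

(** * Truncations in the Grothendieck group *)

Section SlicingK0.
Context {k : fieldType} {D : triangulated_category k} {R : realType}.
Variable P : R -> D -> Prop.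
Hypothesis slP : is_slicing P.
Implicit Types (a b c : R) (E F G X Y Z : D).

(** M measures the failure of truncation to be exact. It is the cone of C[1] -> L -> G^{>c}[1],
    which gives its class and lower phase bound; the triangle J -> M -> E^{<=c}[2] gives the upper
    bound. *)
Lemma truncation_K0 c E F G Egt Ele Fgt Fle Ggt Gle :
  exact_triangle E F G -> exact_triangle Egt E Ele ->
  exact_triangle Fgt F Fle -> exact_triangle Ggt G Gle ->
  hom_gt P c Egt -> hom_gt P c Fgt -> hom_gt P c Ggt ->
  hom_le P c Ele -> hom_le P c Fle -> hom_le P c Gle ->
  exists M, [/\ hom_gt P (c + 1) M, hom_le P (c + 2) M,
    K0_class Fgt = K0_class Egt + K0_class Ggt + K0_class M &
    is_zero Ele \/ is_zero Ggt -> is_zero M].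
Proof.
move=> EFG tE tF tG Egtc Fgtc Ggtc Elec Flec Glec.
have [C [L [J [EFC FGJ CLJ ELG]]]] :=
  truncation_exact slP EFG tE tF tG Egtc Fgtc Flec Glec.
have [M CGM JME] := exact_octahedron CLJ (exact_rotate ELG).
have Cc : hom_gt P c C.
  by apply: (hom_gt_third slP) EFC _ Fgtc; apply: hom_gtW Egtc; lra.
have Jc : hom_le P (c + 1) J.
  apply: (hom_le_third slP) FGJ _ _; first by apply: hom_leW Flec; lra.
  by apply: hom_leW Glec; lra.
have C1 := hom_gt_shift slP Cc.
have Mgt : hom_gt P (c + 1) M.
  apply: (hom_gt_third slP) CGM _ (hom_gt_shift slP Ggtc).
  by apply: hom_gtW C1; lra.
have Mle : hom_le P (c + 2) M.
  apply: (hom_le_ext) JME _ _; first by apply: hom_leW Jc; lra.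
  have -> : c + 2 = c + 1 + 1 by ring.
  by do 2 apply: (hom_le_shift slP).
exists M; split=> //.
  rewrite (K0_class_exact EFC) -addrA; congr (_ + _).
  have := K0_class_exact CGM; rewrite !K0_class_shift => e.
  by rewrite -[LHS]opprK -(addrK (K0_class M) (- K0_class C)) -e opprD !opprK.
case=> [E0|G0].
  apply: (hom_gt_le_zero slP Mgt); apply: hom_le_ext JME Jc _.
  by apply: hom_le_zero; do 2 apply: is_zero_shift.
apply: (hom_gt_le_zero slP (a := c + 2)) => //.
apply: (hom_gt_third slP) CGM _ _; first by apply: hom_gtW C1; lra.
by apply: hom_gt_zero; exact: is_zero_shift.
Qed.

End SlicingK0.

(** * Masses *)

Section Height.
Context {k : fieldType} {D : triangulated_category k} {R : realType}.
Variable sigma : prestability_condition D R.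
Local Notation P := (semistable sigma).
Let slP : is_slicing P := semistable_slicing sigma.
Implicit Types (a b c t : R) (E F G X Y Z : D).

Lemma phase_gt_hom_gt a X : phase_gt sigma a X -> hom_gt P a X.
Proof.
move=> [X0|[H Ha]]; first exact: hom_gt_zero.
by rewrite -(HN_obj_last H); apply: HN_obj_gt.
Qed.

Lemma phase_le_hom_le a X : phase_le sigma a X -> hom_le P a X.
Proof.
move=> [X0|[H Ha]]; first exact: hom_le_zero.
rewrite -(HN_obj_last H).
elim: {-2}(HN_length H) (leqnn (HN_length H)) => [_|j IHj jn].
  by apply: hom_le_zero; exact: HN_obj_first.
apply: hom_le_ext (HN_triangle (Ordinal jn)) (IHj (ltnW jn)) _.
by apply: (hom_le_semistable slP) (HN_factor_semistable _); exact: Ha.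
Qed.

(* The imaginary part of exp(- i pi c) Z(x). *)
Definition height c (x : K0 D) : R :=
  complex.Im (central_charge sigma x) * cos (pi * c)
  - complex.Re (central_charge sigma x) * sin (pi * c).

Lemma heightD c : {morph height c : x y / x + y}.
Proof.
move=> x y; rewrite /height raddfD.
by case: (central_charge sigma x) (central_charge sigma y) => [a b] [a' b'] /=; ring.
Qed.

Lemma height0 c : height c 0 = 0.
Proof. by apply: (addrI (height c 0)); rewrite -heightD !addr0. Qed.

Lemma height_sum c (I : Type) (r : seq I) (Q : pred I) (x : I -> K0 D) :
  height c (\sum_(i <- r | Q i) x i) = \sum_(i <- r | Q i) height c (x i).
Proof. by rewrite (big_morph _ (heightD c) (height0 c)). Qed.

Lemma heightDp1 c x : height (c + 1) x = - height c x.
Proof.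
by rewrite /height mulrDr mulr1 cosDpi sinDpi; ring.
Qed.

Definition normZ X : R := Normc.normc (central_charge sigma (K0_class X)).

Lemma normZ_ge0 X : 0 <= normZ X.
Proof. by rewrite /normZ; case: (central_charge _ _) => x y; exact: sqrtr_ge0. Qed.

Lemma height_semistable c phi X : P phi X -> ~ is_zero X ->
  height c (K0_class X) = normZ X * sin (pi * (phi - c)).
Proof.
move=> PX X0; have [r r0 e] := central_charge_phase PX X0.
rewrite /height /normZ e /= !mul0r subr0 addr0.
rewrite !exprMn -mulrDr cos2Dsin2 mulr1 sqrtr_sqr gtr0_norm //.
by rewrite mulrBr sinB; ring.
Qed.

Definition HN_height E (H : HN_filtration P E) c : R :=
  \sum_(i < HN_length H) normZ (HN_factor i) * sin_bump (HN_phase i - c).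

Lemma HN_height_truncation E (H : HN_filtration P E) c : exists X0 X1 Y0 Y1,
  [/\ exact_triangle X0 E Y0 /\ exact_triangle X1 E Y1,
    hom_gt P c X0 /\ hom_gt P (c + 1) X1,
    hom_le P c Y0 /\ hom_le P (c + 1) Y1
    & HN_height H c = height c (K0_class X0) - height c (K0_class X1)].
Proof.
have [X0 [Y0 [t0 g0 l0 k0]]] := HN_truncation slP H c.
have [X1 [Y1 [t1 g1 l1 k1]]] := HN_truncation slP H (c + 1).
exists X0, X1, Y0, Y1; split=> //.
rewrite k0 k1 !height_sum big_mkcond [in X in _ - X]big_mkcond -sumrB.
apply: eq_bigr => i _.
rewrite (height_semistable c (HN_factor_semistable _) (@HN_factor_neq0 _ _ _ _ _ H i)).
rewrite /sin_bump.
rewrite subr_gt0 ltrBlDr [1 + c]addrC.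
have [c1i|ic1|e1] := ltrgtP (c + 1) (HN_phase i).
- have ci : c < HN_phase i by lra.
  by rewrite ci /= mulr0 subrr.
- have [ci|ic] := ltP c (HN_phase i); first by rewrite subr0.
  by rewrite subr0 mulr0.
(* The difference of truncations keeps phase c + 1, which the open bump omits, but there the height
   is a multiple of sin(pi) = 0. *)
- have ci : c < HN_phase i by lra.
  by rewrite ci -e1 addrAC subrr add0r mulr1 sinpi !mulr0 subr0.
Qed.

(** All HN phases of M lie in (c + 1, c + 2], where sin(pi (phi - c)) is nonpositive. *)
Lemma height_le0 c M : hom_gt P (c + 1) M -> hom_le P (c + 2) M ->
  height c (K0_class M) <= 0.
Proof.
move=> Mgt Mle; have [H] := HN_filtration_exists slP M.
have -> : K0_class M = K0_class (HN_obj H (HN_length H)) by rewrite HN_obj_last.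
rewrite K0_class_HN_obj // height_sum.
apply: sumr_le0 => i _.
rewrite (height_semistable c (HN_factor_semistable _) (@HN_factor_neq0 _ _ _ _ _ H i)).
apply: mulr_ge0_le0; first exact: normZ_ge0.
have c1i := HN_phase_gt slP Mgt i; have ic2 := HN_phase_le slP Mle i.
rewrite -[pi * _](subrK pi) sinDpi oppr_le0; apply: sin_ge0_pi.
have pi0 := pi_ge0 R.
rewrite -[in X in _ - X](mulr1 pi) -mulrBr mulr_ge0 //=; last lra.
by rewrite ler_piMr //; lra.
Qed.

(** * Heights along exact triangles *)

Section HeightExact.
Variables (E F G : D) (EFG : exact_triangle E F G).
Variables (HE : HN_filtration P E) (HF : HN_filtration P F).
Variable HG : HN_filtration P G.

(* [m0] and [m1] come from the objects M of truncation_K0 at c and c + 1. *)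
Lemma HN_height_exact c : exists2 m0 : R, m0 <= 0 & exists2 m1 : R, m1 <= 0 &
  (forall a, hom_gt P a E -> hom_le P a G -> m0 = 0 /\ m1 = 0) /\
  HN_height HF c = HN_height HE c + HN_height HG c + m0 + m1.
Proof.
have [E0 [E1 [E0' [E1' [[tE0 tE1] [gE0 gE1] [lE0 lE1] ->]]]]] :=
  HN_height_truncation HE c.
have [F0 [F1 [F0' [F1' [[tF0 tF1] [gF0 gF1] [lF0 lF1] ->]]]]] :=
  HN_height_truncation HF c.
have [G0 [G1 [G0' [G1' [[tG0 tG1] [gG0 gG1] [lG0 lG1] ->]]]]] :=
  HN_height_truncation HG c.
have [M0 [gM0 lM0 -> zM0]] :=
  truncation_K0 slP EFG tE0 tF0 tG0 gE0 gF0 gG0 lE0 lF0 lG0.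
have [M1 [gM1 lM1 -> zM1]] :=
  truncation_K0 slP EFG tE1 tF1 tG1 gE1 gF1 gG1 lE1 lF1 lG1.
exists (height c (K0_class M0)); first exact: height_le0.
exists (height (c + 1) (K0_class M1)); first exact: height_le0.
(* The truncations at c + 1 enter with a minus sign, which [heightDp1] absorbs, so both error terms
   appear with a plus sign. *)
split; last by rewrite heightDp1 !heightD; ring.
(* Either d <= a and E has no part of phase at most [d], or a <= d and G has no part of phase above
   [d]. *)
have split0 d X X' Y Y' a : exact_triangle X E X' -> exact_triangle Y G Y' ->
    hom_gt P d X -> hom_gt P d Y -> hom_le P d X' -> hom_le P d Y' ->
    hom_gt P a E -> hom_le P a G -> is_zero X' \/ is_zero Y.
  move=> tX tY gX gY lX lY aE aG; have [da|/ltW ad] := leP d a.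
    left; apply: (hom_gt_le_zero slP _ lX).
    apply: (hom_gt_third slP) tX _ _; first by apply: hom_gtW gX; lra.
    exact: hom_gtW aE.
  right; apply: (hom_gt_le_zero slP gY).
  apply: (hom_le_first slP) tY _ _; first exact: hom_leW aG.
  by apply: hom_leW lY; lra.
move=> a aE aG.
have Z0 := zM0 (split0 _ _ _ _ _ _ tE0 tG0 gE0 gG0 lE0 lG0 aE aG).
have Z1 := zM1 (split0 _ _ _ _ _ _ tE1 tG1 gE1 gG1 lE1 lG1 aE aG).
by rewrite !K0_class_zero // !height0.
Qed.

Lemma HN_height_le c : HN_height HF c <= HN_height HE c + HN_height HG c.
Proof.
have [m0 m0le [m1 m1le [_ ->]]] := HN_height_exact c; lra.
Qed.

Lemma HN_height_split a c : hom_gt P a E -> hom_le P a G ->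
  HN_height HF c = HN_height HE c + HN_height HG c.
Proof.
move=> aE aG; have [m0 _ [m1 _ [/(_ a aE aG)[-> ->] ->]]] := HN_height_exact c.
by rewrite !addr0.
Qed.

End HeightExact.

(** * From heights to masses *)

Definition HN_mass t E (H : HN_filtration P E) : R :=
  \sum_(i < HN_length H) normZ (HN_factor i) * expR (t * HN_phase i).

Lemma mass_HN_mass t E :
  exists H : HN_filtration P E, mass sigma t E = HN_mass t H.
Proof.
rewrite /mass; case: pselect => [E0|E0]; last by exists (HN sigma E0).
have [H] := HN_filtration_exists slP E; exists H.
rewrite /HN_mass big1 // => i _.
(* A zero object satisfies every bound, so a factor would have phase strictly above itself; hence
   the sum is empty. *)
by have := HN_phase_gt slP (@hom_gt_zero _ _ _ P (HN_phase i) _ E0) i; rewrite ltxx.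
Qed.

Lemma HN_mass_le t E F G (HE : HN_filtration P E) (HF : HN_filtration P F)
    (HG : HN_filtration P G) :
  exact_triangle E F G -> HN_mass t HF <= HN_mass t HE + HN_mass t HG.
Proof.
move=> EFG; pose w (s : 'I_(HN_length HE) + 'I_(HN_length HG)) :=
  match s with inl i => (normZ (HN_factor i), HN_phase i)
             | inr i => (normZ (HN_factor i), HN_phase i) end.
have := @sum_expR_le_of_sin_bump R _ _ (fun i => normZ (@HN_factor _ _ _ _ _ HF i))
  (fun i => HN_phase i) (fun s => (w s).1) (fun s => (w s).2) t.
rewrite big_sumType /=; apply.
- by move=> i; exact: normZ_ge0.
- by case=> i; exact: normZ_ge0.
- by move=> c; rewrite big_sumType; exact: HN_height_le.
Qed.

Lemma HN_mass_split t a E F G (HE : HN_filtration P E) (HF : HN_filtration P F)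
    (HG : HN_filtration P G) :
  exact_triangle E F G -> hom_gt P a E -> hom_le P a G ->
  HN_mass t HE + HN_mass t HG <= HN_mass t HF.
Proof.
move=> EFG aE aG; pose w (s : 'I_(HN_length HE) + 'I_(HN_length HG)) :=
  match s with inl i => (normZ (HN_factor i), HN_phase i)
             | inr i => (normZ (HN_factor i), HN_phase i) end.
have := @sum_expR_le_of_sin_bump R _ _ (fun s => (w s).1) (fun s => (w s).2)
  (fun i => normZ (@HN_factor _ _ _ _ _ HF i)) (fun i => HN_phase i) t.
rewrite big_sumType /=; apply.
- by case=> i; exact: normZ_ge0.
- by move=> i; exact: normZ_ge0.
- move=> c; rewrite big_sumType le_eqVlt; apply/orP; left; apply/eqP/esym.
  exact: (HN_height_split EFG _ _ _ _ aE aG).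
Qed.

(** Subadditivity on E -> E -> 0, with different filtrations on the two copies of E and in both
    orders, gives independence of the filtration. *)
Lemma mass_HN t E (H : HN_filtration P E) : mass sigma t E = HN_mass t H.
Proof.
have [H' ->] := mass_HN_mass t E; have [O O0] := has_zero D.
have [HO mO] := mass_HN_mass t O.
have {}mO : HN_mass t HO = 0 by rewrite -mO /mass; case: pselect => // /(_ O0).
have EEO := exact_zero_third E O0.
apply/eqP; rewrite eq_le.
have := HN_mass_le t H H' HO EEO; have := HN_mass_le t H' H HO EEO.
by rewrite mO !addr0 => -> ->.
Qed.

Lemma mass_ge0 t E : 0 <= mass sigma t E.
Proof.
have [H ->] := mass_HN_mass t E; apply: sumr_ge0 => i _.
by rewrite mulr_ge0 ?normZ_ge0 ?expR_ge0.
Qed.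

Lemma mass_le t E F G : exact_triangle E F G ->
  mass sigma t F <= mass sigma t E + mass sigma t G.
Proof.
have [HE ->] := mass_HN_mass t E; have [HF ->] := mass_HN_mass t F.
by have [HG ->] := mass_HN_mass t G; exact: HN_mass_le.
Qed.

Lemma mass_split t a E F G : exact_triangle E F G ->
  hom_gt P a E -> hom_le P a G ->
  mass sigma t F = mass sigma t E + mass sigma t G.
Proof.
move=> EFG aE aG; apply/eqP; rewrite eq_le mass_le //=; move: EFG aE aG.
have [HE ->] := mass_HN_mass t E; have [HF ->] := mass_HN_mass t F.
by have [HG ->] := mass_HN_mass t G; exact: HN_mass_split.
Qed.

Lemma normZ_shift X : normZ (shift X) = normZ X.
Proof.
rewrite /normZ K0_class_shift raddfN.
by case: (central_charge _ _) => x y /=; rewrite !sqrrN.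
Qed.

(** Shifting a filtration preserves the norms of the charges and raises each phase by one. *)
Lemma mass_shift t E : mass sigma t (shift E) = expR t * mass sigma t E.
Proof.
have [H ->] := mass_HN_mass t E.
have H0 (i : 'I_(HN_length H)) : ~ is_zero (shift (HN_factor i)).
  by move=> /is_zero_unshift; exact: HN_factor_neq0.
have phi1 (i j : 'I_(HN_length H)) : HN_phase j < HN_phase i ->
    HN_phase j + 1 < HN_phase i + 1 by rewrite ltrD2r.
pose H1 := @HNFiltration _ _ _ P (shift E) (HN_length H)
  (fun j => shift (HN_obj H j)) (fun i => shift (HN_factor i))
  (fun i => HN_phase i + 1) (is_zero_shift (HN_obj_first H))
  (congr1 _ (HN_obj_last H)) (fun i => exact_shift (HN_triangle i)) H0
  (fun i => semistable_shift slP (HN_factor_semistable i))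
  (fun i j ij => phi1 i j (HN_phase_decr ij)).
rewrite (mass_HN t H1) /HN_mass mulr_sumr; apply: eq_bigr => i _ /=.
by rewrite normZ_shift mulrDr mulr1 expRD; ring.
Qed.

End Height.

(** * Both bounds on the mass defect *)

Theorem theorem4 (k : fieldType) (D : triangulated_category k) (R : realType)
    (sigma : prestability_condition D R) (E F G : D) (EFG : exact_triangle E F G)
    (a t : R) :
  0 <= mass sigma t E + mass sigma t G - mass sigma t F
    <= (1 + expR `|t|) *
       (mass sigma t (trunc_gt sigma a G) + mass sigma t (trunc_le sigma a E)).
Proof.
apply/andP; split; first by rewrite subr_ge0; exact: mass_le.
have slP := semistable_slicing sigma.
rewrite /trunc_gt /trunc_le.
case: (trunc sigma a E) => Egt Ele /= /phase_gt_hom_gt gE /phase_le_hom_le lE tE.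
case: (trunc sigma a G) => Ggt Gle /= /phase_gt_hom_gt gG /phase_le_hom_le lG tG.
case: (trunc sigma a F) => Fgt Fle /phase_gt_hom_gt gF /phase_le_hom_le lF tF.
have [C [L [J [EFC FGJ CLJ ELG]]]] := truncation_exact slP EFG tE tF tG gE gF lF lG.
have gC : hom_gt (semistable sigma) (a + 1) (shift C).
  apply: (hom_gt_shift slP); apply: (hom_gt_third slP) EFC _ gF.
  by apply: hom_gtW gE; lra.
have lJ : hom_le (semistable sigma) (a + 1) J.
  apply: (hom_le_third slP) FGJ _ _; first by apply: hom_leW lF; lra.
  by apply: hom_leW lG; lra.
have mE := mass_le sigma t tE; have mG := mass_le sigma t tG.
have mF := mass_split t tF gF lF.
(* C[1] and J lie on opposite sides of phase a + 1, so the mass of L is exactly e^t m(C) + m(J). *)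
have mL := mass_le sigma t ELG; rewrite (mass_split t CLJ gC lJ) !mass_shift in mL.
have mC := mass_le sigma t (exact_rotate (exact_rotate EFC)).
rewrite !mass_shift in mC.
have mJ := mass_le sigma t FGJ.
have C0 := mass_ge0 sigma t C; have J0 := mass_ge0 sigma t J.
have T0 : 0 < expR t := expR_gt0 t.
(* The total error e^{-t} m(C) + m(J), multiplied by e^t. For t >= 0 it is compared with [mL] using
   1 <= e^{2t} on m(C), for t < 0 using e^{2t} <= 1 on m(J). *)
have errP : mass sigma t C + expR t * mass sigma t J <=
    expR t * (expR `|t| * (mass sigma t Ggt + mass sigma t Ele)).
  have [t0|t0] := leP 0 t.
    have T1 : 1 <= expR t by rewrite -expR0 ler_expR.
    have CT : mass sigma t C <= expR t * (expR t * mass sigma t C).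
      by rewrite mulrA ler_peMl // mulr_ege1.
    have := mL; rewrite -(ler_pM2l T0) ger0_norm //; lra.
  have T1 : expR t <= 1 by rewrite -expR0 ler_expR ltW.
  have TA : expR t * expR (- t) = 1 by rewrite -expRD subrr expR0.
  rewrite ltr0_norm // mulrA TA mul1r -(ler_pM2l T0).
  have JT : expR t * (expR t * mass sigma t J) <= mass sigma t J.
    by rewrite mulrA ler_piMl // mulr_ile1 // ltW.
  lra.
have : expR t * (mass sigma t Egt + mass sigma t Gle - mass sigma t F) <=
    expR t * (expR `|t| * (mass sigma t Ggt + mass sigma t Ele)).
  have : expR t * mass sigma t Gle <= expR t * (mass sigma t Fle + mass sigma t J).
    by rewrite ler_pM2l.
  by rewrite mF; lra.
(* Replacing m(E) and m(G) by the masses of their truncations, via [mE] and [mG], costs m(E^{<=a}) +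
   m(G^{>a}): the summand 1 of the constant. *)
by rewrite ler_pM2l //; lra.
Qed.
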